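(* Let $k,r\ge1$ be integers. For a standard Young tableau $T$ of shape $r^k=(r,r,\dots,r)$ ($k$ rows of length $r$) and $1\le \ell\le kr$, let $T_\ell$ be the subtableau consisting of the boxes of $T$ with labels $\le \ell$, and let $c(T_\ell)$ be the number of boxes in the first row of $T_\ell$. Let $d(T_\ell)=c(T_\ell)$ if $\ell<kr$ and the box labeled $\ell+1$ occurs in $T$ in a higher row than the box labeled $\ell$, and let $d(T_\ell)=0$ otherwise. Then $$F_{k,r}(x)=\sum_{T\in \mathbf{SYT}(r^k)}\ \prod_{\ell=1}^{kr}\frac{x^{d(T_\ell)}}{1-x^{c(T_\ell)}},$$ where $\mathbf{SYT}(r^k)$ is the set of standard Young tableaux of shape $r^k$.
   Context: For integers $k,r\ge 1$ and $n\ge 0$, let $\alpha_{k,r}(n)$ be the number of $k\times r$ matrices $(m_{i,j})$ of non-negative integers such that $m_{i,j}\ge m_{i+1,j}$ for $1\le i<k$, $m_{i,j}\ge m_{i,j+1}$ for $1\le j<r$, and $m_{1,1}+\dots+m_{1,r}=n$. Let $F_{k,r}(x)=\sum_{n=0}^\infty \alpha_{k,r}(n)x^n$. Standard Young tableaux are drawn in English notation: the first row is the top row, labels $1,\dots,kr$ are each used once, and labels increase along rows from left to right and down columns; ''higher row'' means a row with smaller row index (closer to the top). *)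

(* Defs.v *)
From HB Require Import structures.
From mathcomp Require Import all_boot all_order all_algebra finmap.
From mathcomp Require Import boolp classical_sets cardinality.

Set Implicit Arguments.
Unset Strict Implicit.
Unset Printing Implicit Defensive.

Import GRing.Theory.
Local Open Scope ring_scope.

Record fps (R : Type) := FPS { fps_coef : nat -> R }.

Notation "{ 'fps' R }" := (fps R) (at level 0, format "{ 'fps'  R }").

HB.instance Definition _ (R : Type) := gen_eqMixin {fps R}.
HB.instance Definition _ (R : Type) := gen_choiceMixin {fps R}.

Lemma fpsP (R : Type) (f g : {fps R}) : fps_coef f =1 fps_coef g <-> f = g.
Proof.
split=> [|-> //]; case: f => f; case: g => g /= fg.
by congr FPS; apply/funext.
Qed.

Definition fps_zero (R : nmodType) : {fps R} := FPS (fun=> 0).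
Definition fps_opp (R : zmodType) (f : {fps R}) := FPS (fun n => - fps_coef f n).
Definition fps_add (R : nmodType) (f g : {fps R}) :=
  FPS (fun n => fps_coef f n + fps_coef g n).
Definition fps_one (R : pzSemiRingType) : {fps R} :=
  FPS (fun n => (n == 0%N)%:R).
Definition fps_mul (R : pzSemiRingType) (f g : {fps R}) :=
  FPS (fun n => \sum_(i < n.+1) fps_coef f i * fps_coef g (n - i)).

Lemma fps_addA (R : zmodType) : associative (@fps_add R).
Proof. by move=> f g h; apply/fpsP => n /=; rewrite addrA. Qed.

Lemma fps_addC (R : zmodType) : commutative (@fps_add R).
Proof. by move=> f g; apply/fpsP => n /=; rewrite addrC. Qed.

Lemma fps_add0 (R : zmodType) : left_id (@fps_zero R) (@fps_add R).
Proof. by move=> f; apply/fpsP => n /=; rewrite add0r. Qed.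

Lemma fps_addN (R : zmodType) :
  left_inverse (@fps_zero R) (@fps_opp R) (@fps_add R).
Proof. by move=> f; apply/fpsP => n /=; rewrite addNr. Qed.

HB.instance Definition _ (R : zmodType) := GRing.isZmodule.Build {fps R}
  (@fps_addA R) (@fps_addC R) (@fps_add0 R) (@fps_addN R).

Lemma fps_coef_mul_trunc (R : nzRingType) (N : nat) (f g : {fps R}) (n : nat) :
  (n < N)%N -> fps_coef (fps_mul f g) n =
    ((\poly_(i < N) fps_coef f i) * (\poly_(i < N) fps_coef g i))`_n.
Proof.
move=> nN; rewrite coefM /=; apply: eq_bigr => i _.
rewrite !coef_poly (leq_ltn_trans (leq_subr _ _) nN).
by rewrite (leq_ltn_trans (ltn_ord i : (i <= n)%N) nN).
Qed.

Lemma fps_mulA (R : comNzRingType) : associative (@fps_mul R).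
Proof.
move=> f g h; apply/fpsP => n /=.
pose t (u : {fps R}) := \poly_(i < n.+1) fps_coef u i.
transitivity ((t f * (t g * t h))`_n); last rewrite mulrA.
  rewrite coefM; apply: eq_bigr => i _; congr (_ * _).
    by rewrite coef_poly ltn_ord.
  exact: (@fps_coef_mul_trunc R n.+1 g h (n - i) (leq_subr i n)).
rewrite coefM; apply: eq_bigr => i _; congr (_ * _).
  by rewrite -(@fps_coef_mul_trunc R n.+1 f g i (ltn_ord i)).
by rewrite coef_poly ltnS leq_subr.
Qed.

Lemma fps_mulC (R : comNzRingType) : commutative (@fps_mul R).
Proof.
by move=> f g; apply/fpsP => n; rewrite !(@fps_coef_mul_trunc _ n.+1) // mulrC.
Qed.

Lemma fps_mul1 (R : comNzRingType) : left_id (@fps_one R) (@fps_mul R).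
Proof.
move=> f; apply/fpsP => n /=.
rewrite big_ord_recl /= mul1r subn0 big1 ?addr0 // => i _.
by rewrite mul0r.
Qed.

Lemma fps_mulDl (R : comNzRingType) : left_distributive (@fps_mul R) +%R.
Proof.
move=> f g h; apply/fpsP => n /=; rewrite -big_split /=.
by apply: eq_bigr => i _; rewrite mulrDl.
Qed.

Lemma fps_one_neq0 (R : comNzRingType) : @fps_one R != 0.
Proof.
by apply/eqP => /fpsP /(_ 0%N) /= /eqP; rewrite oner_eq0.
Qed.

HB.instance Definition _ (R : comNzRingType) :=
  GRing.Zmodule_isComNzRing.Build {fps R} (@fps_mulA R) (@fps_mulC R)
    (@fps_mul1 R) (@fps_mulDl R) (@fps_one_neq0 R).

Definition fps_unit (R : comNzRingType) : {pred {fps R}} :=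
  fun f => `[< exists g, g * f = 1 >].

(* the inverse of f if there is one, and f itself otherwise *)
Definition fps_inv (R : comNzRingType) (f : {fps R}) : {fps R} :=
  xget f [set g | g * f = 1]%classic.

Lemma fps_mulV (R : comNzRingType) :
  {in @fps_unit R, left_inverse 1 (@fps_inv R) *%R}.
Proof. by move=> f /asboolP ex; apply: (xgetPex f ex). Qed.

Lemma fps_unitPl (R : comNzRingType) (f g : {fps R}) :
  g * f = 1 -> fps_unit f.
Proof. by move=> gf; apply/asboolP; exists g. Qed.

Lemma fps_inv_out (R : comNzRingType) :
  {in [predC @fps_unit R], @fps_inv R =1 id}.
Proof.
move=> f /negP nf; apply: xgetPN => g gf.
by apply: nf; apply: (fps_unitPl gf).
Qed.

HB.instance Definition _ (R : comNzRingType) :=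
  GRing.ComNzRing_hasMulInverse.Build {fps R} (@fps_mulV R) (@fps_unitPl R)
    (@fps_inv_out R).

Definition fpsX (R : pzSemiRingType) : {fps R} := FPS (fun n => (n == 1%N)%:R).

Lemma fps_coefXn (R : comNzRingType) (m n : nat) :
  fps_coef (fpsX R ^+ m) n = (n == m)%:R.
Proof.
elim: m n => [//|m IH] [|n]; rewrite exprS /=.
  by rewrite big_ord1 /= mul0r.
rewrite 2!big_ord_recl /= mul0r add0r mul1r subn1 /= IH big1 ?addr0 // => i _.
by rewrite mul0r.
Qed.

Lemma fps_coefXnM (R : comNzRingType) (m n : nat) (f : {fps R}) :
  fps_coef (fpsX R ^+ m * f) n = if (n < m)%N then 0 else fps_coef f (n - m).
Proof.
rewrite [LHS]/= (eq_bigr (fun i : 'I_n.+1 =>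
  (i == m :> nat)%:R * fps_coef f (n - i))); last first.
  by move=> i _; rewrite fps_coefXn.
case: ltnP => [nm|mn].
  rewrite big1 // => i _; rewrite ltn_eqF ?mul0r //.
  exact: leq_ltn_trans (ltn_ord i : (i <= n)%N) nm.
rewrite (bigD1 (Ordinal (mn : (m < n.+1)%N))) //= eqxx mul1r big1 ?addr0 // => i.
by rewrite -val_eqE /= => /negPf ->; rewrite mul0r.
Qed.

(* 1 / (1 - x^c) is the geometric series as soon as c > 0 *)
Lemma fps_geomM (R : comNzRingType) (c : nat) : (0 < c)%N ->
  FPS (fun n => (c %| n)%:R) * (1 - fpsX R ^+ c) = 1.
Proof.
move=> c0; rewrite mulrC mulrBl mul1r; apply/fpsP => n.
change (fps_coef (FPS (fun n => (c %| n)%:R : R)) n -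
  fps_coef (fpsX R ^+ c * FPS (fun n => (c %| n)%:R)) n = (n == 0%N)%:R).
rewrite fps_coefXnM /=; case: ltnP => [nc|cn].
  rewrite subr0; case: n nc => [|n] nc; first by rewrite dvdn0.
  by rewrite gtnNdvd.
by rewrite dvdn_subl // subrr gtn_eqF // (leq_trans c0 cn).
Qed.

Lemma fps_unit_1subXn (R : comNzRingType) (c : nat) : (0 < c)%N ->
  1 - fpsX R ^+ c \is a GRing.unit.
Proof. by move=> c0; apply: (fps_unitPl (fps_geomM R c0)). Qed.

(* Rows are indexed from the top by 'I_k and columns from the left by 'I_r,
   both starting at 0. *)
Definition decreasing_mx (k r : nat) (m : 'M[nat]_(k, r)) : Prop :=
  (forall (i i' : 'I_k) (j : 'I_r), i' = i.+1 :> nat -> (m i' j <= m i j)%N) /\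
  (forall (i : 'I_k) (j j' : 'I_r), j' = j.+1 :> nat -> (m i j' <= m i j)%N).

Definition first_row_sum (k r : nat) (m : 'M[nat]_(k, r)) : nat :=
  (\sum_(i < k | i == 0 :> nat) \sum_(j < r) m i j)%N.

Definition alpha_set (k r n : nat) : set 'M[nat]_(k, r) :=
  [set m | decreasing_mx m /\ first_row_sum m = n]%classic.
Arguments alpha_set : clear implicits.

(* fset_set has the default value fset0 on infinite sets, hence this lemma *)
Lemma finite_alpha_set (k r n : nat) : finite_set (alpha_set k r n).
Proof.
pose f (M : 'M['I_n.+1]_(k, r)) : 'M[nat]_(k, r) := map_mx (@nat_of_ord _) M.
apply: (@sub_finite_set _ _ (f @` [set: 'M['I_n.+1]_(k, r)])%classic); last first.
  exact/finite_image/finite_finset.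
move=> m [[dr _] sm].
have le_n i j : (m i j <= n)%N.
  have k0 : (0 < k)%N by apply: leq_ltn_trans (ltn_ord i).
  have: (m i j <= m (Ordinal k0) j)%N.
    case: i => i; elim: i => [|i IH] ik; first by rewrite (bool_irrelevance ik k0).
    by apply: leq_trans (IH (ltnW ik)); apply: dr.
  move=> /leq_trans; apply; rewrite -sm /first_row_sum.
  by rewrite (bigD1 (Ordinal k0)) //= (bigD1 j) //= -addnA leq_addr.
exists (\matrix_(i, j) inord (m i j)) => //.
by apply/matrixP => i j; rewrite !mxE inordK // ltnS.
Qed.

Definition alpha (k r n : nat) : nat := #|` fset_set (alpha_set k r n)|.

Definition F (k r : nat) : {fps int} := FPS (fun n => (alpha k r n)%:Z).

(* The box in row i and column j carries the label T i j; as there are k * r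
   boxes, every box gets one of the labels 1, ..., k * r. *)
Definition is_syt (k r : nat) (T : 'M['I_(k * r).+1]_(k, r)) : bool :=
  [&& [forall l : 'I_(k * r).+1, (0 < l)%N ==>
         (#|[set p : 'I_k * 'I_r | T p.1 p.2 == l]| == 1%N)],
      [forall i : 'I_k, forall j : 'I_r, forall j' : 'I_r,
         (j < j')%N ==> (T i j < T i j')%N] &
      [forall j : 'I_r, forall i : 'I_k, forall i' : 'I_k,
         (i < i')%N ==> (T i j < T i' j)%N]].

Definition SYT (k r : nat) : {set 'M['I_(k * r).+1]_(k, r)} :=
  [set T | is_syt T].

Definition subtab (k r : nat) (T : 'M['I_(k * r).+1]_(k, r)) (l : nat) :
  {set 'I_k * 'I_r} := [set p | (T p.1 p.2 <= l)%N].

Definition first_row_size (k r : nat) (B : {set 'I_k * 'I_r}) : nat :=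
  #|[set p in B | p.1 == 0%N :> nat]|.

Definition c (k r : nat) (T : 'M['I_(k * r).+1]_(k, r)) (l : nat) : nat :=
  first_row_size (subtab T l).

Definition next_higher (k r : nat) (T : 'M['I_(k * r).+1]_(k, r)) (l : nat) :
  bool :=
  [exists p : 'I_k * 'I_r, exists q : 'I_k * 'I_r,
    [&& T p.1 p.2 == l :> nat, T q.1 q.2 == l.+1 :> nat & (q.1 < p.1)%N]].

Definition d (k r : nat) (T : 'M['I_(k * r).+1]_(k, r)) (l : nat) : nat :=
  if (l < k * r)%N && next_higher T l then c T l else 0%N.

(* Main.v *)
(* As in the theory of P-partitions, cut the set of matrices m according to the
   standard tableau T that labels the boxes in decreasing order of the entries
   of m, with ties broken in reading order. The entry of m in the box p is then
   the sum of the e_l with l >= T p, where e_l >= 0 is the difference between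
   the entries in the boxes labeled l and l + 1. The only constraint on e is that
   e_l > 0 whenever the label l + 1 is in a higher row than l, since this is when
   a tie would contradict the reading order. The first row of m sums to
   the sum of the c(T_l) e_l, so each l contributes an independent geometric
   series. *)
Require Import Defs.
From mathcomp Require Import all_boot all_order all_algebra finmap.
From mathcomp Require Import boolp classical_sets cardinality.
From mathcomp Require Import zify.
Import GRing.Theory.
Local Open Scope ring_scope.

(** * Standard tableaux of rectangular shape *)

Section StandardTableaux.
Context {k r : nat} {T : 'M['I_(k * r).+1]_(k, r)}.
Hypothesis sytT : is_syt T.

Lemma syt_row {i : 'I_k} {j j' : 'I_r} : (j < j')%N -> (T i j < T i j')%N.
Proof. by case/and3P: sytT => _ /forallP/(_ i)/forallP/(_ j)/forallP/(_ j')/implyP. Qed.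

Lemma syt_col {j : 'I_r} {i i' : 'I_k} : (i < i')%N -> (T i j < T i' j)%N.
Proof. by case/and3P: sytT => _ _ /forallP/(_ j)/forallP/(_ i)/forallP/(_ i')/implyP. Qed.

Lemma syt_card1 {l : 'I_(k * r).+1} :
  (0 < l)%N -> #|[set p : 'I_k * 'I_r | T p.1 p.2 == l]| = 1%N.
Proof. by case/and3P: sytT => /forallP/(_ l)/implyP h _ _ /h/eqP. Qed.

Lemma syt_box {l : nat} :
  (0 < l <= k * r)%N -> exists p : 'I_k * 'I_r, T p.1 p.2 = l :> nat.
Proof.
case/andP=> l0 lN; pose l' := Ordinal (lN : (l < (k * r).+1)%N).
have /eqP/cards1P[p Ep] := @syt_card1 l' l0.
by exists p; have := set11 p; rewrite -Ep inE => /eqP ->.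
Qed.

(** [is_syt] constrains only the positive labels, so the value 0 is excluded by counting: the
    [k * r] positive labels take one box each, which exhausts the boxes. *)
Lemma syt_gt0 (p : 'I_k * 'I_r) : (0 < T p.1 p.2)%N.
Proof.
have: (#|{: 'I_k * 'I_r}| = #|[set q : 'I_k * 'I_r | T q.1 q.2 == ord0]| + k * r)%N.
  rewrite -[LHS]sum1_card [LHS](partition_big (fun q : 'I_k * 'I_r => T q.1 q.2) predT) //=.
  rewrite (bigD1 ord0) //= [X in (X + _)%N]sum1_card; congr (_ + _)%N.
    by apply: eq_card => q; rewrite !inE.
  rewrite (eq_bigr (fun=> 1%N)) => [|l l0].
    by rewrite sum1_card cardC1 card_ord.
  rewrite sum1_card -(@syt_card1 l) ?lt0n //.
  by apply: eq_card => q; rewrite !inE.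
rewrite card_prod !card_ord -{1}[(k * r)%N]add0n => /eqP.
rewrite eqn_add2r eq_sym cards_eq0 => /eqP E0.
rewrite lt0n; apply/negP => p0.
have: p \in [set q : 'I_k * 'I_r | T q.1 q.2 == ord0] by rewrite inE.
by rewrite E0 inE.
Qed.

Lemma syt_inj {p q : 'I_k * 'I_r} : T p.1 p.2 = T q.1 q.2 :> nat -> p = q.
Proof.
move=> Epq; have /eqP/cards1P[s Es] := syt_card1 (syt_gt0 q).
have: p \in [set s] by rewrite -Es inE; apply/eqP/val_inj.
have: q \in [set s] by rewrite -Es inE.
by rewrite !inE => /eqP -> /eqP.
Qed.

(** Recovers a tableau from the order of its boxes alone, which gives the uniqueness of [T] in
    [partition_mx_inj]. *)
Lemma syt_rank (p : 'I_k * 'I_r) :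
  #|[set q : 'I_k * 'I_r | (T q.1 q.2 <= T p.1 p.2)%N]| = T p.1 p.2.
Proof.
pose t (q : 'I_k * 'I_r) := T q.1 q.2.
have inj_t : injective t by move=> q q' /(congr1 val)/syt_inj.
rewrite -(card_imset _ inj_t).
rewrite (_ : _ @: _ = [set l : 'I_(k * r).+1 | 0 < l <= T p.1 p.2]%N); last first.
  apply/setP => l; rewrite inE; apply/imsetP/idP => [[q + ->]|/andP[l0 lp]].
    by rewrite inE syt_gt0.
  have [|q Eq] := @syt_box l; first by rewrite l0 -ltnS ltn_ord.
  by exists q; [rewrite inE Eq|apply/val_inj].
rewrite -sum1_card big_mkcond big_ord_recl inE /= add0n.
rewrite (eq_bigr (fun i : 'I_(k * r) => if (i < T p.1 p.2)%N then 1 else 0)%N); last first.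
  by move=> i _; rewrite inE.
rewrite -big_mkcond -(big_ord_widen _ (fun=> 1%N)) ?sum1_card ?card_ord //.
by rewrite -ltnS.
Qed.

End StandardTableaux.

(** * The matrix of a tableau with exponents, and the order on boxes given by a matrix *)

(** Exponents are indexed from 0 and labels from 1: [e a] belongs to the label [a.+1]. *)
Definition partition_mx {k r : nat} (T : 'M['I_(k * r).+1]_(k, r))
    (e : 'I_(k * r) -> nat) : 'M[nat]_(k, r) :=
  \matrix_(i, j) (\sum_(a < k * r | T i j <= a.+1) e a)%N.

Definition compatible {k r : nat} (T : 'M['I_(k * r).+1]_(k, r))
    (e : 'I_(k * r) -> nat) : bool :=
  [forall a : 'I_(k * r), next_higher T a.+1 ==> (0 < e a)%N].

Definition reading_le {k r : nat} (p q : 'I_k * 'I_r) : bool :=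
  ((p.1 < q.1) || (p.1 == q.1) && (p.2 <= q.2))%N.

(* Labels are assigned in decreasing order of the entries of m, and from top to
   bottom, then from left to right, among equal entries. *)
Definition label_le {k r : nat} (m : 'M[nat]_(k, r)) (p q : 'I_k * 'I_r) : bool :=
  ((m q.1 q.2 < m p.1 p.2) || (m q.1 q.2 == m p.1 p.2) && reading_le p q)%N.

Lemma label_le_refl {k r : nat} (m : 'M[nat]_(k, r)) : reflexive (label_le m).
Proof. by move=> p; rewrite /label_le /reading_le !eqxx leqnn !orbT. Qed.

Lemma label_le_total {k r : nat} (m : 'M[nat]_(k, r)) : total (label_le m).
Proof.
move=> p q; rewrite /label_le /reading_le -!val_eqE /=.
case: (ltngtP (m p.1 p.2) (m q.1 q.2)) => //= _.
by case: (ltngtP p.1 q.1) => //= _; exact: leq_total.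
Qed.

Lemma label_le_anti {k r : nat} (m : 'M[nat]_(k, r)) : antisymmetric (label_le m).
Proof.
move=> [p1 p2] [q1 q2]; rewrite /label_le /reading_le -!val_eqE /=.
case: (ltngtP (m p1 p2) (m q1 q2)) => //= _.
case: (ltngtP p1 q1) => //= E1; rewrite -eqn_leq => /eqP E2.
by congr pair; apply: val_inj.
Qed.

Lemma label_le_trans {k r : nat} (m : 'M[nat]_(k, r)) : transitive (label_le m).
Proof.
move=> q p s; rewrite /label_le /reading_le -!val_eqE /=; lia.
Qed.

Section TableauToMatrix.
Context {k r : nat} {T : 'M['I_(k * r).+1]_(k, r)} {e : 'I_(k * r) -> nat}.
Hypothesis sytT : is_syt T.
Hypothesis compTe : compatible T e.

Lemma partition_mx_homo {p q : 'I_k * 'I_r} :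
  (T p.1 p.2 <= T q.1 q.2)%N ->
  (partition_mx T e q.1 q.2 <= partition_mx T e p.1 p.2)%N.
Proof.
move=> pq; rewrite !mxE big_mkcond [leqRHS]big_mkcond /=.
apply: leq_sum => a _; case: ifP => // qa.
by rewrite (leq_trans pq qa).
Qed.

Lemma decreasing_partition_mx : decreasing_mx (partition_mx T e).
Proof.
split=> [i i' j ii'|i j j' jj'].
  by apply: (@partition_mx_homo (i, j) (i', j)); rewrite ltnW // (syt_col sytT) // ii'.
by apply: (@partition_mx_homo (i, j) (i, j')); rewrite ltnW // (syt_row sytT) // jj'.
Qed.

Lemma first_row_partition_mx :
  first_row_sum (partition_mx T e) = (\sum_(a < k * r) c T a.+1 * e a)%N.
Proof.
rewrite /first_row_sum pair_big_dep /=.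
under eq_bigr do rewrite mxE.
rewrite (exchange_big_dep predT) //=; apply: eq_bigr => a _.
rewrite sum_nat_const; congr (_ * _)%N; apply: eq_card => p.
by rewrite !inE -topredE /= andbT andbC.
Qed.

(** The entry drops by [e a] from [p] to [q]. If [e a] is 0, the entries tie, and compatibility
    forbids [q] to lie in a higher row; within one row the larger label lies further right. Hence
    reading order puts [p] first. *)
Lemma label_le_succ {p q : 'I_k * 'I_r} :
  T q.1 q.2 = (T p.1 p.2).+1 :> nat -> label_le (partition_mx T e) p q.
Proof.
move=> Eq; have p0 := syt_gt0 sytT p.
have aN : ((T p.1 p.2).-1 < k * r)%N.
  by have := ltn_ord (T q.1 q.2); rewrite Eq ltnS prednK // => /ltnW.
pose a := Ordinal aN.
have Ep : partition_mx T e p.1 p.2 = (e a + partition_mx T e q.1 q.2)%N.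
  rewrite !mxE (bigD1 a) /= ?prednK //; congr (_ + _)%N.
  apply: eq_bigl => b; rewrite Eq -val_eqE /=; move: p0; lia.
rewrite /label_le Ep -[X in (X < _)%N]add0n ltn_add2r.
case: posnP => //= ea; rewrite ea add0n eqxx /=.
have /implyP nh := forallP compTe a; rewrite ea in nh.
rewrite /reading_le; case: (ltngtP p.1 q.1) => //= [qp|E1].
  case: notF; apply: nh => /=; apply/existsP; exists p; apply/existsP; exists q.
  by rewrite prednK // eqxx Eq eqxx.
have {}E1 := val_inj E1; rewrite E1 eqxx /= leqNgt; apply/negP => /(syt_row sytT (i := p.1)).
by rewrite {1}E1 Eq; lia.
Qed.

(** Consecutive labels are chained by transitivity, by induction on their gap [n]; the converse
    follows by antisymmetry. *)
Lemma label_le_partition_mx (p q : 'I_k * 'I_r) :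
  label_le (partition_mx T e) p q = (T p.1 p.2 <= T q.1 q.2)%N.
Proof.
have lt_le n : forall p q : 'I_k * 'I_r, T q.1 q.2 = (T p.1 p.2 + n)%N :> nat ->
    label_le (partition_mx T e) p q.
  elim: n => [|n IHn] {}p {}q Eq.
    by rewrite (syt_inj sytT (etrans Eq (addn0 _))) label_le_refl.
  have [|s Es] := @syt_box _ _ _ sytT (T p.1 p.2 + n)%N.
    have := ltn_ord (T q.1 q.2); have := syt_gt0 sytT p; lia.
  apply: (label_le_trans _ s); first exact: IHn.
  by apply: label_le_succ; rewrite Es Eq addnS.
apply/idP/idP => [pq|/subnKC pq]; last exact: (lt_le _ _ _ (esym pq)).
rewrite leqNgt; apply/negP => qp.
have := lt_le _ _ _ (esym (subnKC (ltnW qp))) => qp'.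
have E : p = q by apply: (label_le_anti (partition_mx T e)); rewrite pq.
by move: qp; rewrite E ltnn.
Qed.

(* The entry of the box labeled b + 1, the sum being empty for b = k r. *)
Lemma partition_mx_entry {b : nat} : (b <= k * r)%N ->
  (\sum_(p : 'I_k * 'I_r | T p.1 p.2 == b.+1 :> nat) partition_mx T e p.1 p.2 =
   \sum_(a < k * r | b <= a) e a)%N.
Proof.
rewrite leq_eqVlt => /predU1P[->|bN].
  rewrite big1 => [|p /eqP Ep]; last by have := ltn_ord (T p.1 p.2); rewrite Ep ltnn.
  by rewrite big1 // => a; rewrite leqNgt ltn_ord.
have [//|p Ep] := @syt_box _ _ _ sytT b.+1.
rewrite (big_pred1 p) => [|q /=]; first by rewrite mxE Ep.
apply/eqP/eqP => [Eq|-> //]; apply: (syt_inj sytT).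
by rewrite Ep Eq.
Qed.

Lemma compatible_entry_diff (a : 'I_(k * r)) :
  (e a = \sum_(p : 'I_k * 'I_r | T p.1 p.2 == a.+1 :> nat) partition_mx T e p.1 p.2 -
   \sum_(p : 'I_k * 'I_r | T p.1 p.2 == a.+2 :> nat) partition_mx T e p.1 p.2)%N.
Proof.
rewrite !partition_mx_entry // ?(ltnW (ltn_ord a)) //.
rewrite [X in (_ = X - _)%N](bigD1 a) //= (eq_bigl (fun b : 'I__ => (a < b)%N)) ?addnK // => b.
by rewrite -val_eqE /=; lia.
Qed.

End TableauToMatrix.

(** The matrix fixes the order [label_le], hence [T] through the ranks of the boxes, and then [e] as
    differences of entries. *)
Lemma partition_mx_inj {k r : nat} {T T' : 'M['I_(k * r).+1]_(k, r)}
    {e e' : 'I_(k * r) -> nat} :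
    is_syt T -> compatible T e -> is_syt T' -> compatible T' e' ->
    partition_mx T e = partition_mx T' e' ->
  T = T' /\ e =1 e'.
Proof.
move=> sT ce sT' ce' E; have ET : T = T'.
  apply/matrixP => i j; apply: val_inj.
  rewrite /= -(syt_rank sT (i, j)) -(syt_rank sT' (i, j)).
  apply: eq_card => q; rewrite !inE.
  by rewrite -(label_le_partition_mx sT ce q (i, j)) E (label_le_partition_mx sT' ce').
split=> // a; rewrite (compatible_entry_diff sT ce) E ET.
by rewrite -(compatible_entry_diff sT' ce').
Qed.

(** * From a decreasing matrix to its tableau and exponents *)

Definition label_mx {k r : nat} (m : 'M[nat]_(k, r)) : 'M['I_(k * r).+1]_(k, r) :=
  \matrix_(i, j) inord #|[set q | label_le m q (i, j)]|.

(** Each sum has at most one term, the entry with the given label; for the last [a] the second sum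
    is empty, so the last entry is kept whole. *)
Definition label_diff {k r : nat} (m : 'M[nat]_(k, r)) (a : 'I_(k * r)) : nat :=
  (\sum_(p : 'I_k * 'I_r | label_mx m p.1 p.2 == a.+1 :> nat) m p.1 p.2 -
   \sum_(p : 'I_k * 'I_r | label_mx m p.1 p.2 == a.+2 :> nat) m p.1 p.2)%N.

Lemma label_mxE {k r : nat} (m : 'M[nat]_(k, r)) (p : 'I_k * 'I_r) :
  label_mx m p.1 p.2 = #|[set q | label_le m q p]| :> nat.
Proof.
case: p => i j; rewrite mxE inordK // ltnS.
by apply: leq_trans (max_card _) _; rewrite card_prod !card_ord.
Qed.

(** Labels are sizes of initial segments of a total order; these are nested, so a size comparison
    decides inclusion. *)
Lemma label_mx_le {k r : nat} (m : 'M[nat]_(k, r)) (p q : 'I_k * 'I_r) :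
  (label_mx m p.1 p.2 <= label_mx m q.1 q.2)%N = label_le m p q.
Proof.
have homo (s t : 'I_k * 'I_r) : label_le m s t ->
    [set u | label_le m u s] \subset [set u | label_le m u t].
  by move=> st; apply/fintype.subsetP => u; rewrite !inE => /label_le_trans; apply.
rewrite !label_mxE; apply/idP/idP => [pq|/homo/subset_leq_card //].
case/orP: (label_le_total m p q) => // qp.
have /eqP E : [set u | label_le m u q] == [set u | label_le m u p].
  by rewrite eqEcard homo.
have: p \in [set u | label_le m u p] by rewrite inE label_le_refl.
by rewrite -E inE.
Qed.

Lemma label_mx_inj {k r : nat} (m : 'M[nat]_(k, r)) :
  injective (fun p : 'I_k * 'I_r => label_mx m p.1 p.2).
Proof.
move=> p q E; apply: (label_le_anti m).
by rewrite -!label_mx_le E leqnn.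
Qed.

Lemma label_mx_gt0 {k r : nat} (m : 'M[nat]_(k, r)) (p : 'I_k * 'I_r) :
  (0 < label_mx m p.1 p.2)%N.
Proof.
by rewrite label_mxE; apply/card_gt0P; exists p; rewrite inE label_le_refl.
Qed.

(** Labels are distinct and positive, and there are as many boxes as positive labels. *)
Lemma label_mx_surj {k r : nat} (m : 'M[nat]_(k, r)) (l : 'I_(k * r).+1) :
  (0 < l)%N -> exists p : 'I_k * 'I_r, label_mx m p.1 p.2 = l.
Proof.
move=> l0; pose t (p : 'I_k * 'I_r) := label_mx m p.1 p.2.
suff: l \in t @: finset.setT by case/imsetP => p _ ->; exists p.
suff -> : t @: finset.setT = [set~ ord0] by rewrite !inE -val_eqE /= -lt0n.
apply/eqP; rewrite eqEcard; apply/andP; split.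
  apply/fintype.subsetP => _ /imsetP[p _ ->]; rewrite !inE -val_eqE /= -lt0n.
  exact: label_mx_gt0.
rewrite (card_imset _ (@label_mx_inj _ _ m)) cardsT card_prod !card_ord.
by rewrite cardsC1 card_ord.
Qed.

Section MatrixToTableau.
Context {k r : nat} {m : 'M[nat]_(k, r)}.
Hypothesis decm : decreasing_mx m.

Lemma decreasing_mx_col {i i' : 'I_k} {j : 'I_r} :
  (i <= i')%N -> (m i' j <= m i j)%N.
Proof.
case: decm => dcol _; case: i' => n nk /=; elim: n nk => [|n IHn] nk.
  by rewrite leqn0 => /eqP i0; rewrite (_ : i = Ordinal nk) //; apply: val_inj.
rewrite leq_eqVlt => /predU1P[E|]; first by rewrite (_ : i = Ordinal nk) //; apply: val_inj.
rewrite ltnS => /(IHn (ltnW nk)); apply: leq_trans.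
exact: dcol.
Qed.

Lemma decreasing_mx_row {i : 'I_k} {j j' : 'I_r} :
  (j <= j')%N -> (m i j' <= m i j)%N.
Proof.
case: decm => _ drow; case: j' => n nr /=; elim: n nr => [|n IHn] nr.
  by rewrite leqn0 => /eqP j0; rewrite (_ : j = Ordinal nr) //; apply: val_inj.
rewrite leq_eqVlt => /predU1P[E|]; first by rewrite (_ : j = Ordinal nr) //; apply: val_inj.
rewrite ltnS => /(IHn (ltnW nr)); apply: leq_trans.
exact: drow.
Qed.

(** Along rows and down columns entries weakly decrease, and a tie is resolved in favour of the box
    that is read first. *)
Lemma is_syt_label_mx : is_syt (label_mx m).
Proof.
apply/and3P; split.
- apply/forallP => l; apply/implyP => /(label_mx_surj m)[p Ep].
  apply/cards1P; exists p; apply/setP => q; rewrite !inE -Ep.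
  exact: (inj_eq (@label_mx_inj _ _ m)).
- apply/forallP => i; apply/forallP => j; apply/forallP => j'; apply/implyP => jj'; rewrite ltnNge.
  rewrite (label_mx_le m (_, _) (_, _)) /label_le /reading_le /= eqxx ltnn /=.
  have := @decreasing_mx_row i _ _ (ltnW jj'); move: jj'; lia.
apply/forallP => j; apply/forallP => i; apply/forallP => i'; apply/implyP => ii'; rewrite ltnNge.
rewrite (label_mx_le m (_, _) (_, _)) /label_le /reading_le /= -val_eqE /=.
have := @decreasing_mx_col _ _ j (ltnW ii'); move: ii'; lia.
Qed.

Lemma label_mx_entry (p : 'I_k * 'I_r) :
  (\sum_(q : 'I_k * 'I_r | label_mx m q.1 q.2 == label_mx m p.1 p.2 :> nat)
     m q.1 q.2 = m p.1 p.2)%N.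
Proof.
rewrite (big_pred1 p) // => q /=.
by rewrite val_eqE (inj_eq (@label_mx_inj _ _ m)).
Qed.

Lemma label_mx_entry_homo (a : nat) : (0 < a)%N ->
  (\sum_(q : 'I_k * 'I_r | label_mx m q.1 q.2 == a.+1 :> nat) m q.1 q.2 <=
   \sum_(q : 'I_k * 'I_r | label_mx m q.1 q.2 == a :> nat) m q.1 q.2)%N.
Proof.
move=> a0; have [aN|Na] := ltnP a (k * r); last first.
  by rewrite big1 // => q /eqP E; have := ltn_ord (label_mx m q.1 q.2); rewrite E ltnNge ltnS Na.
have [//|p Ep] := @syt_box _ _ _ is_syt_label_mx a.+1.
have [|q Eq] := @syt_box _ _ _ is_syt_label_mx a; first by rewrite a0 ltnW.
rewrite -Ep -Eq !label_mx_entry.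
have: label_le m q p by rewrite -label_mx_le Ep Eq.
by rewrite /label_le; lia.
Qed.

Lemma partition_mx_label : partition_mx (label_mx m) (label_diff m) = m.
Proof.
apply/matrixP => i j; rewrite mxE /label_diff; pose p := (i, j).
pose v a := (\sum_(q : 'I_k * 'I_r | label_mx m q.1 q.2 == a :> nat) m q.1 q.2)%N.
(* Subtraction is truncated, so the monotonicity of [v] is carried along in the induction. *)
have tele n a : (0 < a)%N -> (\sum_(a <= b < a + n) (v b - v b.+1) = v a - v (a + n))%N /\ (v (a + n) <= v a)%N.
  move=> a0; elim: n => [|n [IHn len]]; first by rewrite addn0 big_geq ?subnn.
  rewrite addnS big_nat_recr ?leq_addr //= IHn.
  have := label_mx_entry_homo (a + n); rewrite -/(v _) -/(v _).
  move: len; lia.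
have p0 := label_mx_gt0 m p; have pN := ltnW (ltn_ord (label_mx m p.1 p.2)).
(* The sum runs up to the label [(k * r).+1], which no box carries, so [v] vanishes there. *)
have [] := tele ((k * r).+1 - label_mx m p.1 p.2)%N _ p0.
rewrite subnKC // {3}/v label_mx_entry [v (_.+1)]big1 => [|q /eqP E]; last first.
  by have := ltn_ord (label_mx m q.1 q.2); rewrite E ltnn.
rewrite subn0 => <- _; rewrite (big_nat_widenl _ 1) // big_add1 /= big_mkord.
by apply: eq_bigl => a.
Qed.

(** When the next label sits in a higher row, a tie would contradict reading order, so the entry
    drops strictly. *)
Lemma compatible_label : compatible (label_mx m) (label_diff m).
Proof.
apply/forallP => a; apply/implyP => /existsP[p /existsP[q /and3P[/eqP Ep /eqP Eq qp]]].
rewrite /label_diff -Eq -Ep !label_mx_entry subn_gt0.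
have: label_le m p q by rewrite -label_mx_le Ep Eq.
rewrite /label_le /reading_le -val_eqE /=; lia.
Qed.

End MatrixToTableau.

(** * Geometric series and the coefficients of one product *)

(** The top box of the column containing label 1 has a label at most 1. Positivity makes [1 - x^c]
    invertible. *)
Lemma c_gt0 {k r : nat} {T : 'M['I_(k * r).+1]_(k, r)} {l : nat} :
  (0 < k)%N -> (0 < r)%N -> is_syt T -> (0 < l)%N -> (0 < c T l)%N.
Proof.
move=> k0 r0 sT l0; have N0 : (0 < k * r)%N by rewrite muln_gt0 k0.
have [|p Ep] := @syt_box _ _ _ sT 1; first by [].
apply/card_gt0P; exists (Ordinal k0, p.2); rewrite !inE /= andbT.
apply: (leq_trans _ l0); rewrite -Ep; case: p {Ep} => [i j] /=.
have := leq0n i; rewrite leq_eqVlt => /predU1P[i0|/(@syt_col _ _ _ sT j (Ordinal k0) i)/ltnW //].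
by rewrite (_ : i = Ordinal k0) //; apply: val_inj.
Qed.

Lemma next_higher_lt {k r : nat} {T : 'M['I_(k * r).+1]_(k, r)} {l : nat} :
  next_higher T l -> (l < k * r)%N.
Proof.
case/existsP=> p /existsP[q /and3P[_ /eqP Eq _]].
by have := ltn_ord (T q.1 q.2); rewrite Eq ltnS.
Qed.

Lemma dE {k r : nat} (T : 'M['I_(k * r).+1]_(k, r)) (l : nat) :
  d T l = (c T l * next_higher T l)%N.
Proof.
rewrite /d; case: (boolP (next_higher T l)) => [/next_higher_lt ->|_].
  by rewrite muln1.
by rewrite andbF muln0.
Qed.

(** Agreement modulo [x^(n+1)]; it lets finite sums replace the geometric series, so that finite
    distributivity expands the product. *)
Definition fps_eq_upto {R : Type} (n : nat) (f g : {fps R}) : Prop :=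
  forall i, (i <= n)%N -> fps_coef f i = fps_coef g i.

Lemma fps_eq_upto_prod {R : comNzRingType} {I : Type} (s : seq I) (P : pred I)
    (n : nat) (f g : I -> {fps R}) :
  (forall i, P i -> fps_eq_upto n (f i) (g i)) ->
  fps_eq_upto n (\prod_(i <- s | P i) f i) (\prod_(i <- s | P i) g i).
Proof.
move=> fg; apply: big_rec2 => // i u v Pi uv j jn /=.
apply: eq_bigr => a _; rewrite (fg _ Pi) ?uv //.
  by rewrite (leq_trans (leq_subr _ _)).
by rewrite (leq_trans _ jn) // -ltnS.
Qed.

Lemma fps_coef_sum {R : comNzRingType} {I : Type} (s : seq I) (P : pred I)
    (f : I -> {fps R}) (n : nat) :
  fps_coef (\sum_(i <- s | P i) f i) n = \sum_(i <- s | P i) fps_coef (f i) n.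
Proof. by apply: (big_morph (fun u : {fps R} => fps_coef u n)). Qed.

Lemma fps_geom_trunc {R : comNzRingType} (n c : nat) (b : bool) : (0 < c)%N ->
  fps_eq_upto n (fpsX R ^+ (c * b) / (1 - fpsX R ^+ c))
                (\sum_(a < n.+1 | b ==> (0 < a)%N) fpsX R ^+ (c * a)).
Proof.
move=> c0 i le_in.
rewrite (mulr1_eq (etrans (mulrC _ _) (fps_geomM R c0))) fps_coefXnM /= fps_coef_sum.
under eq_bigr do rewrite fps_coefXn.
(* Off the multiples of [c] both coefficients vanish; in degree [q * c] only the term [a = q] can
   contribute. *)
have [/dvdnP[q Eq]|ndiv] := boolP (c %| i)%N; last first.
  rewrite big1 => [|a _]; last first.
    case: eqP => // E; case/negP: ndiv; rewrite E dvdn_mulr //.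
  case: ltnP => // le; case: (boolP (c %| _)%N) => // di.
  by case/negP: ndiv; rewrite -(subnK le) dvdn_add // dvdn_mulr.
have qn : (q < n.+1)%N by rewrite ltnS (leq_trans _ le_in) // Eq leq_pmulr.
rewrite big_mkcond (bigD1 (Ordinal qn)) //= big1 => [|a]; last first.
  rewrite -val_eqE Eq mulnC eqn_pmul2l //= eq_sym => /negPf ->.
  by case: ifP.
rewrite Eq mulnC ltn_pmul2l // eqxx addr0.
case: b => /=; last by rewrite muln0 subn0 dvdn_mulr.
case: q {Eq qn} => [|q] //=; by rewrite muln1 mulnS addKn dvdn_mulr.
Qed.

(** Expanding the truncated factors amounts to choosing one exponent [e a] per label, subject to
    compatibility. *)
Lemma coef_syt_prod {k r : nat} {T : 'M['I_(k * r).+1]_(k, r)} (n : nat) :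
  (0 < k)%N -> (0 < r)%N -> is_syt T ->
  fps_coef (\prod_(1 <= l < (k * r).+1)
    (fpsX int ^+ d T l / (1 - fpsX int ^+ c T l))) n =
  \sum_(e : {ffun 'I_(k * r) -> 'I_n.+1} | compatible T (fun a => e a) &&
     (\sum_(a < k * r) c T a.+1 * e a == n)%N) 1.
Proof.
move=> k0 r0 sT; rewrite big_add1 big_mkord /=.
rewrite (fps_eq_upto_prod _ _ n _ (fun a : 'I_(k * r) =>
  \sum_(b < n.+1 | next_higher T a.+1 ==> (0 < b)%N) fpsX int ^+ (c T a.+1 * b))) //;
  last by move=> a _; rewrite dE; apply: fps_geom_trunc; apply: c_gt0.
rewrite (bigA_distr_big_dep (fun (a : 'I_(k * r)) (b : 'I_n.+1) => next_higher T a.+1 ==> (0 < b)%N)).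
rewrite fps_coef_sum big_mkcondr /=.
apply: eq_big => [e|e _]; first by [].
by rewrite prodrXr fps_coefXn eq_sym; case: eqP.
Qed.

(** * The bijection with pairs of a tableau and exponents, and the final count *)

Lemma alpha_eq {k r n : nat} : (0 < k)%N -> (0 < r)%N ->
  alpha k r n = #|[set Te : 'M['I_(k * r).+1]_(k, r) * {ffun 'I_(k * r) -> 'I_n.+1} |
    [&& is_syt Te.1, compatible Te.1 (fun a => Te.2 a) &
      (\sum_(a < k * r) c Te.1 a.+1 * Te.2 a == n)%N]]|.
Proof.
move=> k0 r0; set D := [set Te | _].
pose f (Te : 'M['I_(k * r).+1]_(k, r) * {ffun 'I_(k * r) -> 'I_n.+1}) :=
  partition_mx Te.1 (fun a => Te.2 a).
have fD : {in D &, injective f}.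
  move=> [T e] [T' e']; rewrite !inE /= => /and3P[sT ce _] /and3P[sT' ce' _] E.
  have [<- Ee] := partition_mx_inj sT ce sT' ce' E.
  by congr pair; apply/ffunP => a; apply: val_inj; exact: Ee.
rewrite /alpha; suff -> : fset_set (alpha_set k r n) = [fset f Te | Te in D]%fset.
  by rewrite card_in_imfset // -cardE.
apply/fsetP => m; rewrite in_fset_set; last exact: finite_alpha_set.
apply/idP/imfsetP => [|[[T e]]]; rewrite !inE /=; last first.
  case/and3P=> sT ce /eqP En ->; split; first exact: decreasing_partition_mx.
  by rewrite first_row_partition_mx.
case=> decm sumn.
have sT := is_syt_label_mx decm.
have En : (\sum_(a < k * r) c (label_mx m) a.+1 * label_diff m a)%N = n.
  by rewrite -first_row_partition_mx partition_mx_label.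
(* As every [c] is at least 1, no exponent exceeds the weighted sum [n], so the exponents fit in
   ['I_n.+1]. *)
have le_n a : (label_diff m a < n.+1)%N.
  rewrite ltnS -En (bigD1 a) //=; apply: leq_trans (leq_addr _ _).
  by rewrite leq_pmull // c_gt0.
pose e := [ffun a => Ordinal (le_n a)].
have Ee : (fun a => e a : nat) = label_diff m by apply/funext => a; rewrite ffunE.
exists (label_mx m, e); last by rewrite /f /= Ee partition_mx_label.
rewrite inE /= sT Ee compatible_label //=.
apply/eqP; rewrite -[RHS]En; apply: eq_bigr => a _.
by rewrite -Ee.
Qed.

Theorem theorem3 (k r : nat) (hk : (1 <= k)%N) (hr : (1 <= r)%N) :
  F k r =
  \sum_(T in SYT k r) \prod_(1 <= l < (k * r).+1)
    (fpsX int ^+ d T l / (1 - fpsX int ^+ c T l)).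
Proof.
apply/fpsP => n; rewrite fps_coef_sum /= (alpha_eq hk hr).
rewrite (eq_bigr (fun T => \sum_(e : {ffun 'I_(k * r) -> 'I_n.+1} |
    compatible T (fun a => e a) && (\sum_(a < k * r) c T a.+1 * e a == n)%N) 1));
  last by move=> T; rewrite inE => sT; apply: coef_syt_prod.
rewrite pair_big_dep /= sumr_const natz; congr Posz.
by apply: eq_card => -[T e]; rewrite !inE -topredE /= inE.
Qed.
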